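(* For any integer $d>0$, we have $\mathrm{ATC}(\mathbb{RP}^d)=1$.
   Context: Convenient spaces. A topological space is convenient if it is Hausdorff and a subset is closed whenever its intersection with every compact subset is closed. All spaces are convenient; limits (including products and pullbacks) and mapping spaces are formed in the category of convenient spaces (take the ordinary one and retopologize with the weak topology with respect to compact subsets). $\Delta^{n-1}=\{(t_1,\ldots,t_n)\in[0,1]^n:\sum_i t_i=1\}$. Measures of finite support. For a space $X$, $\mathcal{P}(X)$ is the quotient space of $\bigsqcup_{n>0}X^n\times\Delta^{n-1}$ by the equivalence relation generated by: (1) simultaneous permutation of $(x_1,\ldots,x_n)$ and $(t_1,\ldots,t_n)$; (2) $(x_1,\ldots,x_n,t_1,\ldots,t_n)\sim(x_1,\ldots,x_{n-1},t_1,\ldots,t_{n-2},t_{n-1}+t_n)$ if $x_{n-1}=x_n$; (3) $(x_1,\ldots,x_n,t_1,\ldots,t_n)\sim(x_1,\ldots,x_{n-1},t_1,\ldots,t_{n-1})$ if $t_n=0$. The class of $(x_1,\ldots,x_n,t_1,\ldots,t_n)$ is written $\sum_i t_i\delta_{x_i}$. Every $\mu\in\mathcal{P}(X)$ is uniquely of this form with all $t_i>0$ and the $x_i$ distinct; then $\mathrm{supp}(\mu)=\{x_1,\ldots,x_n\}$. $\mathcal{P}_n(X)$ is the subspace of $\mu$ with $|\mathrm{supp}(\mu)|\le n$. Relative version. For a continuous map $f:X\to Y$, $\mathcal{P}(f)=\{\mu\in\mathcal{P}(X):|f(\mathrm{supp}(\mu))|=1\}$ with the subspace topology, $\mathcal{P}_n(f)=\mathcal{P}_n(X)\cap\mathcal{P}(f)$,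 and the projection $\mathcal{P}(f)\to Y$ sends $\mu$ to the unique point of $f(\mathrm{supp}(\mu))$; it is continuous. The analog sectional category $\mathrm{asecat}(f)$ is the least $n\ge 0$ such that the projection $\mathcal{P}(f)\to Y$ admits a continuous section with image in $\mathcal{P}_{n+1}(f)$ ($\infty$ if there is none). Analog topological complexity. For a path connected space $X$, $\mathrm{ATC}(X)=\mathrm{ATC}_2(X)=\mathrm{asecat}(\pi_X^2)$, where $\pi^2_X:X^{[0,1]}\to X\times X$ is $\gamma\mapsto(\gamma(0),\gamma(1))$. *)

(* Defs.v *)
From HB Require Import structures.
From Stdlib Require Import Relation_Operators.
From mathcomp Require Import all_boot all_order all_fingroup all_algebra.
From mathcomp Require Import generic_quotient.
From mathcomp Require Import all_classical all_reals all_analysis.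

Set Implicit Arguments.
Unset Strict Implicit.
Unset Printing Implicit Defensive.

Import Order.TTheory GRing.Theory Num.Theory.
Import numFieldNormedType.Exports.

Local Open Scope classical_set_scope.
Local Open Scope ring_scope.
Local Open Scope quotient_scope.
Local Open Scope card_scope.

(* [kification T] is [T] retopologized with the weak topology with respect to
   its compact subsets. Openness is tested in the subspace [K] (where the
   points outside [K] are isolated) so that this is a topology for every [T];
   for Hausdorff [T], [kification_closedP] below is the usual description. *)
Definition kification (T : Type) : Type := T.

Section kification.
Variable T : topologicalType.

Definition kopen (U : set T) : Prop :=
  forall K : set T, compact K -> open (U : set (subspace K)).

Let kopenT : kopen setT.
Proof. by move=> K _; exact: openT. Qed.

Let kopenI : setI_closed kopen.
Proof. by move=> U V oU oV K cK; apply: openI; [exact: oU|exact: oV]. Qed.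

Let kopen_bigcup (I : Type) (F : I -> set T) :
  (forall i, kopen (F i)) -> kopen (\bigcup_i F i).
Proof.
by move=> oF K cK; apply: (@bigcup_open (subspace K)) => i _; exact: oF.
Qed.

HB.instance Definition _ := Choice.copy (kification T) T.
HB.instance Definition _ :=
  isOpenTopological.Build (kification T) kopenT kopenI kopen_bigcup.

Lemma kification_openE (U : set T) :
  open (U : set (kification T)) = kopen U.
Proof. by []. Qed.

Lemma kification_closedP (A : set T) : hausdorff_space T ->
  closed (A : set (kification T)) <->
  forall K : set T, compact K -> closed (A `&` K).
Proof.
move=> hT.
have kE K : compact K -> closed (A `&` K) = open (~` A : set (subspace K)).
  move=> cK; rewrite openC.
  exact: (@closed_setIS T K (A : set (subspace K)) (compact_closed hT cK)).
split=> [cA K cK|cA].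
- by rewrite kE //; move: cA; rewrite -openC kification_openE => /(_ K cK).
- by rewrite -openC kification_openE => K cK; rewrite -kE //; exact: cA.
Qed.

End kification.

Lemma kification_continuous (S T : topologicalType) (f : S -> T) :
  continuous f -> continuous (f : kification S -> kification T).
Proof.
move=> cf; apply/continuousP => U; rewrite !kification_openE => oU K cK.
have cfK : compact (f @` K).
  by apply: continuous_compact => //; exact: continuous_subspaceT.
have /open_subspaceP [V oV VU] := oU _ cfK.
apply/open_subspaceP; exists (f @^-1` V).
  by apply: open_comp => // x _; exact: cf.
apply/seteqP; split=> x [fx Kx]; split=> //.
- have : (V `&` f @` K) (f x) by split=> //; exists x.
  by rewrite VU => -[].
- have : (U `&` f @` K) (f x) by split=> //; exists x.
  by rewrite -VU => -[].
Qed.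

(* The definitions below are meant for convenient spaces [X], [Y] (Hausdorff,
   with [kification X] = [X]). Products and mapping spaces are kified; disjoint
   unions, quotients and subspaces carry their ordinary topology. *)

Section finite_measures.
Variable R : realType.

(* The standard simplex on [n] coordinates, of dimension [n - 1]. *)
Definition simplex (n : nat) : set {ptws 'I_n -> R} :=
  [set t | (forall i, 0 <= t i <= 1) /\ \sum_i t i = 1].
Arguments simplex n _ : clear implicits.

Variable X : topologicalType.

(* The index [n] stands for [n.+1] points, so that every tuple is nonempty. *)
Definition wtuple : Type :=
  {n : nat & kification ({ptws 'I_n.+1 -> X} * simplex n.+1)%type}.
HB.instance Definition _ := Topological.on wtuple.

Definition mkwtuple n (x : 'I_n.+1 -> X) (t : simplex n.+1) : wtuple :=
  existT (fun n : nat =>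
    kification ({ptws 'I_n.+1 -> X} * simplex n.+1)%type) n (x, t).

Definition winit n : 'I_n.+1 -> 'I_n.+2 := widen_ord (leqnSn n.+1).

(* The weights [t'] on the right are prescribed by equations instead of being
   constructed, which spares proofs that they lie in the simplex. *)
Inductive wstep : wtuple -> wtuple -> Prop :=
| wstep_perm n (s : 'S_n.+1) (x : 'I_n.+1 -> X) (t t' : simplex n.+1) :
    (forall i, val t' i = val t (s i)) ->
    wstep (mkwtuple x t) (mkwtuple (x \o s) t')
| wstep_merge n (x : 'I_n.+2 -> X) (t : simplex n.+2) (t' : simplex n.+1) :
    x (winit ord_max) = x ord_max ->
    (forall i, val t' i =
       val t (winit i) + (if i == ord_max then val t ord_max else 0)) ->
    wstep (mkwtuple x t) (mkwtuple (x \o @winit n) t')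
| wstep_drop n (x : 'I_n.+2 -> X) (t : simplex n.+2) (t' : simplex n.+1) :
    val t ord_max = 0 ->
    (forall i, val t' i = val t (winit i)) ->
    wstep (mkwtuple x t) (mkwtuple (x \o @winit n) t').

Definition wequiv : rel wtuple :=
  fun p q => `[< clos_refl_sym_trans wtuple wstep p q >].

Let wequiv_refl : reflexive wequiv.
Proof. by move=> p; apply/asboolP; exact: rst_refl. Qed.

Let wequiv_sym : symmetric wequiv.
Proof. by move=> p q; apply/asboolP/asboolP => h; exact: rst_sym. Qed.

Let wequiv_trans : transitive wequiv.
Proof.
by move=> q p r /asboolP pq /asboolP qr; apply/asboolP; exact: rst_trans qr.
Qed.

Canonical wequiv_equivRel :=
  EquivRel wequiv wequiv_refl wequiv_sym wequiv_trans.

Definition fmeasure : Type := quotient_topology {eq_quot wequiv}.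
HB.instance Definition _ := Topological.on fmeasure.

(* [dirac_sum x t] is the class written \sum_i t_i \delta_(x_i). *)
Definition dirac_sum n (x : 'I_n.+1 -> X) (t : simplex n.+1) : fmeasure :=
  \pi_fmeasure (mkwtuple x t).

(* The points of the reduced form of [mu], which exists and is unique up to
   permutation. *)
Definition supp (mu : fmeasure) : set X :=
  [set p | exists n (x : 'I_n.+1 -> X) (t : simplex n.+1),
     [/\ mu = dirac_sum x t, injective x, forall i, 0 < val t i
       & exists i, x i = p]].

Definition fmeasure_le (n : nat) : set fmeasure :=
  [set mu | supp mu #<= `I_n].

End finite_measures.

Arguments simplex R n _ : clear implicits.

Section relative.
Variables (R : realType) (X Y : topologicalType) (f : X -> Y).

Definition fmeasure_over : set (fmeasure R X) :=
  [set mu | exists y : Y, f @` supp mu = [set y]].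

Definition fmeasure_proj (mu : fmeasure_over) : Y :=
  projT1 (cid (set_mem (valP mu))).

Lemma fmeasure_projE (mu : fmeasure_over) :
  f @` supp (val mu) = [set fmeasure_proj mu].
Proof. exact: projT2 (cid (set_mem (valP mu))). Qed.

Definition asecat_bound (n : nat) : Prop :=
  exists s : Y -> fmeasure_over,
    [/\ continuous s, forall y, fmeasure_proj (s y) = y
      & forall y, fmeasure_le n.+1 (val (s y))].

(* The least admissible [n], or [+oo]: see [asecat_natP] and [asecat_pinftyP]. *)
Definition asecat : \bar R :=
  ereal_inf [set n%:R%:E | n in asecat_bound].

Lemma asecat_natP (n : nat) : asecat = n%:R%:E <->
  asecat_bound n /\ forall m, asecat_bound m -> (n <= m)%N.
Proof.
split=> [an|[bn nmin]]; last first.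
  apply/le_anti/andP; split; first by apply: ereal_inf_lbound; exists n.
  by apply: le_ereal_inf_tmp => _ [m bm <-]; rewrite lee_fin ler_nat; exact: nmin.
have lb m : asecat_bound m -> (n <= m)%N.
  move=> bm; rewrite -(ler_nat R) -lee_fin -an.
  by apply: ereal_inf_lbound; exists m.
split=> //; apply: contrapT => nbn.
have : ((n.+1%:R)%:E <= asecat)%E.
  apply: le_ereal_inf_tmp => _ [m bm <-]; rewrite lee_fin ler_nat.
  rewrite ltn_neqAle lb // andbT; apply/eqP => nm.
  by apply: nbn; rewrite nm.
by rewrite an lee_fin ler_nat ltnn.
Qed.

Lemma asecat_pinftyP : asecat = +oo%E <-> forall n, ~ asecat_bound n.
Proof.
split=> [ai n bn|nb]; last first.
  rewrite /asecat (_ : [set _ | _ in _] = set0) ?ereal_inf0//.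
  by apply/seteqP; split=> [y [n /nb]|].
have : (asecat <= n%:R%:E)%E by apply: ereal_inf_lbound; exists n.
by rewrite ai leNgt ltry.
Qed.

End relative.

Section topological_complexity.
Variable R : realType.

Definition unit_interval : Type := set_type (`[0, 1]%classic : set R).
HB.instance Definition _ := Topological.on unit_interval.

Lemma unit0_subproof : (0 : R) \in (`[0, 1]%classic : set R).
Proof. by apply: mem_set; rewrite /= in_itv /= lexx ler01. Qed.

Lemma unit1_subproof : (1 : R) \in (`[0, 1]%classic : set R).
Proof. by apply: mem_set; rewrite /= in_itv /= lexx ler01. Qed.

Definition unit0 : unit_interval := exist _ 0 unit0_subproof.
Definition unit1 : unit_interval := exist _ 1 unit1_subproof.

Variable X : topologicalType.

(* Continuous maps [0, 1] -> X with the compact-open topology. *)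
Definition pathspace : Type := continuousType unit_interval X.
HB.instance Definition _ := Choice.on pathspace.
HB.instance Definition _ := Topological.copy pathspace
  (initial_topology (fun g : continuousType unit_interval X =>
     (g : unit_interval -> X) : {compact-open, unit_interval -> X})).

Definition path_endpoints (g : kification pathspace) : kification (X * X)%type :=
  ((g : continuousType unit_interval X) unit0,
   (g : continuousType unit_interval X) unit1).

Lemma path_endpoints_continuous : continuous path_endpoints.
Proof.
pose ev (t : unit_interval) (g : pathspace) : X :=
  (g : continuousType unit_interval X) t.
have evE t : continuous (ev t).
  apply/continuousP => U oU.
  exists [set h : {compact-open, unit_interval -> X} | h @` [set t] `<=` U].
    by apply: compact_open_open => //; exact: compact_set1.
  apply/seteqP; split=> g /=; last by move=> gU _ [_ -> <-].
  by apply; exists t.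
apply: (@kification_continuous pathspace (X * X)%type
  (fun g => (ev unit0 g, ev unit1 g))).
by move=> g; exact: (cvg_pair (evE unit0 g) (evE unit1 g)).
Qed.

Definition ATC : \bar R := asecat R path_endpoints.

End topological_complexity.

Section projective_space.
Variables (R : realType) (d : nat).

Definition sphere : set 'rV[R]_d.+1 := [set x | \sum_i x 0 i ^+ 2 = 1].

Definition antipodal : rel sphere :=
  fun x y => (val x == val y) || (val x == - val y).

Let antipodal_refl : reflexive antipodal.
Proof. by move=> x; rewrite /antipodal eqxx. Qed.

Let antipodal_sym : symmetric antipodal.
Proof.
by move=> x y; rewrite /antipodal [val y == _]eq_sym -eqr_oppLR [- _ == _]eq_sym.
Qed.

Let antipodal_trans : transitive antipodal.
Proof.
move=> y x z /orP[] /eqP xy /orP[] /eqP yz; rewrite /antipodal xy yz.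
- by rewrite eqxx.
- by rewrite eqxx orbT.
- by rewrite eqxx orbT.
- by rewrite opprK eqxx.
Qed.

Canonical antipodal_equivRel :=
  EquivRel antipodal antipodal_refl antipodal_sym antipodal_trans.

Definition RP : Type := quotient_topology {eq_quot antipodal}.
HB.instance Definition _ := Topological.on RP.

End projective_space.

(* Main.v *)
(** Upper bound: two lines [x], [y] in projective space are joined by two great
    arcs, from x to y and from x to -y. Weighting their Dirac masses by
    (1 + <x, y>) / 2 and (1 - <x, y>) / 2 is independent of the choice of x and
    y, and gives an arc weight zero exactly when it is not determined by its
    endpoints. Weight zero alone does not make this continuous in the quotient
    topology: the arcs must in addition stay in a compact set, so they are run
    at constant speed. The section is then the descent of a continuous map
    defined on the compact space of triples (x, v, a) with v a unit vector
    orthogonal to x and a in [0, pi] along the quotient map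
    (x, v, a) |-> ([x], [cos a x + sin a v]).

    Lower bound: a section by Dirac masses is a continuous choice of paths, so
    it contracts the loop r |-> [X r] for X a half great circle. Lifting the
    paths to vectors yields v with v r nonzero on the line through X r, and
    v 1 = v 0 while X 1 = - X 0; hence <v r, X r> vanishes somewhere, which is
    absurd. *)

Require Import Defs.
From Stdlib Require Import Relation_Operators.
From mathcomp Require Import all_boot all_order all_fingroup all_algebra.
From mathcomp Require Import generic_quotient ring lra.
From mathcomp Require Import all_classical all_reals all_analysis.

Set Implicit Arguments.
Unset Strict Implicit.
Unset Printing Implicit Defensive.

Import Order.TTheory GRing.Theory Num.Theory.
Import numFieldNormedType.Exports.

Local Open Scope classical_set_scope.
Local Open Scope ring_scope.
Local Open Scope quotient_scope.
Local Open Scope card_scope.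

(** * Point-set topology: kification and maps out of compact spaces *)

Lemma cluster_continuous (S T : topologicalType) (f : S -> T) (p q : S) :
  hausdorff_space T -> continuous f -> cluster (nbhs p) q -> f p = f q.
Proof.
move=> hT cf cpq; apply: hT => A B nA nB.
have [x [Ax Bx]] := cpq _ _ (cf _ _ nA) (cf _ _ nB).
by exists (f x).
Qed.

Lemma continuous_kification_val (T : topologicalType) :
  continuous (id : kification T -> T).
Proof.
by apply/continuousP => U oU; rewrite kification_openE => K _; exact: open_subspaceW.
Qed.

(** The image of [f] is a single compact set, and a kified open set agrees on it with an ordinary
    open set. This gives access to kified products and path spaces from compact sources. *)
Lemma continuous_to_kification (S T : topologicalType) (f : S -> T) :
  compact [set: S] -> continuous f -> continuous (f : S -> kification T).
Proof.
move=> cS cf; apply/continuousP => U; rewrite kification_openE => oU.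
have cfS : compact (f @` setT).
  by apply: continuous_compact => //; exact: continuous_subspaceT.
have /open_subspaceP [V oV VU] := oU _ cfS.
rewrite (_ : _ @^-1` _ = f @^-1` V); first by move/continuousP: cf; exact.
have fS x : (f @` setT) (f x) by exists x.
apply/seteqP; split=> x /= Ux.
- by have : (U `&` f @` setT) (f x) by []; rewrite -VU => -[].
- by have : (V `&` f @` setT) (f x) by []; rewrite VU => -[].
Qed.

Lemma compact_set_type (T : topologicalType) (A : set T) :
  compact A -> compact [set: A].
Proof.
move=> cA F PF _.
have FA : (set_val @ F) A.
  by apply: (@filterE _ F _ (set_val @^-1` A)) => x; exact: set_valP.
have [p [Ap cp]] := cA (set_val @ F) _ FA.
exists (exist _ p (mem_set Ap)); split=> // U V FU nV.
have [W [[W' oW' <-] /= Wp] WV] := nV.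
have FU' : (set_val @ F) (set_val @` U) by apply: (@filterS _ F _ U) FU => x Ux; exists x.
have [_ [[x Ux <-] W'x]] := cp _ _ FU' (open_nbhs_nbhs (conj oW' Wp)).
by exists x; split=> //; exact: WV.
Qed.

(** A continuous surjection from a compact space to a Hausdorff space is closed, hence a quotient
    map, so the continuity of [s] can be tested after composition with [q]. *)
Lemma continuous_factor (Z B P : topologicalType) (q : Z -> B) (g : Z -> P)
    (s : B -> P) :
  compact [set: Z] -> hausdorff_space B -> continuous q -> continuous g ->
  (forall b, exists z, q z = b) -> (forall z, s (q z) = g z) -> continuous s.
Proof.
move=> cZ hB cq cg qs sq; apply/continuous_closedP => A cA.
rewrite (_ : s @^-1` A = q @` (g @^-1` A)).
  apply: compact_closed => //; apply: continuous_compact.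
    exact: continuous_subspaceT.
  apply: subclosed_compact _ cZ _ => //.
  by move/continuous_closedP : cg; exact.
apply/seteqP; split=> [b /= Ab|_ [z Az <-] /=]; last by rewrite sq.
by have [z zb] := qs b; exists z => //=; rewrite -sq zb.
Qed.

Lemma continuous_ptws (S T : topologicalType) (I : Type)
    (f : S -> {ptws I -> T}) :
  (forall i, continuous (fun s => f s i)) -> continuous f.
Proof.
move=> cf x; apply/cvg_sup => i.
by apply: (@continuous_comp_initial _ _ _ (fun g => g i)); exact: cf.
Qed.

Lemma continuous_pair (S T U : topologicalType) (f : S -> T) (g : S -> U) :
  continuous f -> continuous g -> continuous (fun x => (f x, g x)).
Proof. by move=> cf cg x; exact: (cvg_pair (cf x) (cg x)). Qed.

(** * The mass that a finitely supported measure gives to a set *)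

Section mass.
Variables (R : realType) (X : topologicalType).
Implicit Types (A : set X) (mu : fmeasure R X).

Lemma dirac_sum_eq n m (x : 'I_n.+1 -> X) (t : simplex R n.+1)
    (y : 'I_m.+1 -> X) (u : simplex R m.+1) :
  dirac_sum x t = dirac_sum y u <->
  clos_refl_sym_trans (wtuple R X) (@wstep R X) (mkwtuple x t) (mkwtuple y u).
Proof.
split=> [/eqmodP /asboolP //|h].
by apply/eqmodP/asboolP.
Qed.

Definition wmass A (p : wtuple R X) : R :=
  \sum_(i < (projT1 p).+1 | (projT2 p).1 i \in A) val (projT2 p).2 i.

(** Two merged points coincide, so they lie both inside or both outside [A]; a dropped point has
    weight zero; a permutation only reindexes the sum. *)
Lemma wmass_wstep A (p q : wtuple R X) : wstep p q -> wmass A p = wmass A q.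
Proof.
case=> [n s x t t' tt'|n x t t' xm tt'|n x t t' t0 tt']; rewrite /wmass /=.
- rewrite (reindex_inj (@perm_inj _ s)) /=.
  by apply: eq_bigr => i _; rewrite tt'.
- rewrite [LHS]big_mkcond big_ord_recr /= -big_mkcond /=.
  under [RHS]eq_bigr do rewrite tt'.
  rewrite big_split /=; congr (_ + _).
  rewrite -big_mkcondr /= -xm.
  case: ifPn => xA; last first.
    rewrite big_pred0 // => i; apply/negbTE; apply: contra xA => /andP[xi /eqP <-].
    exact: xi.
  by rewrite (big_pred1 ord_max) // => i /=; case: eqP => [->|]; rewrite ?andbF ?andbT.
- rewrite [LHS]big_mkcond big_ord_recr /= -big_mkcond /= t0 if_same addr0.
  by apply: eq_bigr => i _; rewrite tt'.
Qed.

Lemma wmass_equiv A (p q : wtuple R X) :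
  clos_refl_sym_trans _ (@wstep R X) p q -> wmass A p = wmass A q.
Proof. by elim=> // [? ? /wmass_wstep -> //|? ? ? _ -> _ ->]. Qed.

Definition fmass A mu : R := wmass A (repr mu).

Lemma fmass_pi A (p : wtuple R X) : fmass A (\pi_(fmeasure R X) p) = wmass A p.
Proof.
apply: wmass_equiv.
suff /eqmodP/asboolP : \pi_(fmeasure R X) (repr (\pi_(fmeasure R X) p)) =
  \pi_(fmeasure R X) p by [].
by rewrite reprK.
Qed.

Lemma fmass_dirac_sum A n (x : 'I_n.+1 -> X) (t : simplex R n.+1) :
  fmass A (dirac_sum x t) = \sum_(i < n.+1 | x i \in A) val t i.
Proof. exact: fmass_pi. Qed.

(** The tuple [x] may repeat points or carry zero weights, whereas [supp] refers to a reduced form.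
    Comparing the mass of the singleton of [p] in both representatives avoids any reduction
    procedure. *)
Lemma supp_dirac_sum_sub n (x : 'I_n.+1 -> X) (t : simplex R n.+1) :
  supp (dirac_sum x t) `<=` [set p | exists2 i, x i = p & 0 < val t i].
Proof.
move=> p [m [y [u [yu yi u0 [j yj]]]]].
have : 0 < fmass [set p] (dirac_sum x t).
  rewrite yu fmass_dirac_sum (bigD1 j) ?inE //=.
  apply: ltr_pwDl (u0 j) _; rewrite sumr_ge0 // => i _; exact: ltW (u0 i).
rewrite fmass_dirac_sum => s0.
have [i /andP[xi ti]] : exists i, (x i \in [set p]) && (0 < val t i).
  apply: contrapT => h; move: s0; rewrite big1 ?ltxx // => i xi.
  have /negP : ~ (0 < val t i) by move=> ti; apply: h; exists i; rewrite xi ti.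
  rewrite -leNgt => ti; apply/eqP; rewrite eq_le ti /=.
  by have [/(_ i)/andP[]] := set_valP t.
by exists i => //; move: xi; rewrite inE.
Qed.

Lemma supp_dirac_sum n (x : 'I_n.+1 -> X) (t : simplex R n.+1) :
  injective x -> (forall i, 0 < val t i) ->
  supp (dirac_sum x t) = range x.
Proof.
move=> xi t0; apply/seteqP; split=> [p /supp_dirac_sum_sub [i <- _]|p [i _ <-]].
  by exists i.
by exists n, x, t; split=> //; exists i.
Qed.

(** Lower semicontinuity of mass on open sets: for a nearby tuple the points that were in [A] are
    still there with total weight above [c], and any point entering [A] adds a nonnegative
    weight. *)
Lemma open_fmass_gt A (c : R) : open A -> open [set mu | c < fmass A mu].
Proof.
move=> oA.
suff : open ((\pi_(fmeasure R X) : wtuple R X -> fmeasure R X) @^-1`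
  [set mu | c < fmass A mu]) by [].
apply/(@sigT_openP nat (fun n =>
  kification ({ptws 'I_n.+1 -> X} * simplex R n.+1)%type)) => n.
rewrite kification_openE => K _.
pose XS : topologicalType := ({ptws 'I_n.+1 -> X} * simplex R n.+1)%type.
(* The preimage is open already for the ordinary product topology, hence relatively to every compact
   set. *)
apply (@open_subspaceW XS K).
rewrite openE => -[x t] /=; rewrite fmass_pi /wmass /= => ct.
pose J := [pred i | x i \in A].
have nx : \forall y \near (x : {ptws 'I_n.+1 -> X}), forall i, J i -> A (y i).
  apply: (@filter_forall _ _ (fun i (y : {ptws 'I_n.+1 -> X}) => J i -> A (y i))
    (nbhs x)) => i; have [|_] := boolP (J i); last first.
    by apply: nearW => y.
  rewrite /J /= inE => Axi.
  have : nbhs x (proj i @^-1` A).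
    by apply: (@proj_continuous _ (fun=> X) i x); exact: open_nbhs_nbhs.
  by apply: filterS => y.
have nt : \forall u \near t, c < \sum_(i | J i) val u i.
  have cs : continuous (fun u : simplex R n.+1 => \sum_(i | J i) val u i).
    apply: continuous_big => [|i _ u]; first by move=> -[a b]; exact: add_continuous.
    apply: (@continuous_comp (simplex R n.+1) {ptws 'I_n.+1 -> R} R val (proj i)).
      exact: initial_continuous.
    exact: (@proj_continuous _ (fun=> R)).
  have : nbhs (\sum_(i | J i) val t i) [set r | c < r].
    by apply: open_nbhs_nbhs; split => //; exact: open_gt.
  by move/cs.
exists ([set y : {ptws 'I_n.+1 -> X} | forall i, J i -> A (y i)],
        [set u : simplex R n.+1 | c < \sum_(i | J i) val u i]).
  by split.
move=> [y u] /= [yA cu]; rewrite fmass_pi /wmass /=; apply: lt_le_trans cu _.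
rewrite big_mkcond [leRHS]big_mkcond /=; apply: ler_sum => i _.
have u0 : 0 <= val u i by have [/(_ i)/andP[]] := set_valP u.
case: ifPn => Ji; last by case: ifP.
by rewrite ifT // inE; exact: yA.
Qed.

End mass.

(** * From a section by Dirac masses to a section of the map itself *)

Lemma card_le_I1_eq (T : Type) (A : set T) (a b : T) :
  A #<= `I_1 -> A a -> A b -> a = b.
Proof.
move=> /card_leP[h] Aa Ab.
pose a' : A := exist _ a (mem_set Aa); pose b' : A := exist _ b (mem_set Ab).
suff : a' = b' by case.
have I1 (u v : `I_1) : u = v.
  case: u v => [u hu] [v hv]; apply: val_inj => /=.
  by move: hu hv; rewrite !inE /=; case: u v => [|//] [|//].
by apply: (@inj _ _ [set: A] h); rewrite ?inE //; exact: I1.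
Qed.

(* A Dirac mass lies at a point of [W] iff it gives [W] mass more than 1 / 2,
   which is an open condition on all of [fmeasure]. *)
Lemma asecat_bound0_section (R : realType) (X Y : topologicalType) (f : X -> Y) :
  asecat_bound R f 0 -> exists2 g : Y -> X, continuous g & forall y, f (g y) = y.
Proof.
move=> [s [cs sK s1]].
have gP y : exists p, f p = y /\
    forall A, fmass A (val (s y)) = if p \in A then 1 else 0.
  have sE := fmeasure_projE (s y); rewrite sK in sE.
  have [p sp fp] : (f @` supp (val (s y))) y by rewrite sE.
  exists p; split=> // A.
  have [n [x [t [sxt xi t0 _]]]] := sp.
  have xp i : x i = p.
    apply: card_le_I1_eq (s1 y) _ sp.
    by rewrite sxt supp_dirac_sum //; exists i.
  rewrite sxt fmass_dirac_sum; case: ifP => pA; last first.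
    by rewrite big_pred0 // => i; rewrite xp.
  under eq_bigl => i do rewrite xp pA.
  by have [_] := set_valP t.
have [g gE] := choice gP.
exists g => [|y]; last by have [] := gE y.
apply/continuousP => W oW.
have -> : g @^-1` W = (val \o s) @^-1` [set mu | 1 / 2 < fmass W mu].
  apply/seteqP; split=> y /=; rewrite (gE y).2.
    by move=> gW; rewrite ifT ?inE //; lra.
  by case: ifP => [|_]; rewrite ?inE //; lra.
have cvs : continuous (val \o s).
  by move=> y; apply: continuous_comp (cs y) _; exact: initial_continuous.
by move/continuousP : cvs; apply; exact: open_fmass_gt.
Qed.

(** * Measures with at most two atoms *)

Section two_point.
Variables (R : realType) (X : topologicalType).
Implicit Types (a b : X) (c : R).

Lemma weight1_subproof : (fun=> 1 : R) \in simplex R 1.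
Proof. by apply: mem_set; split=> [i|]; rewrite ?ler01 ?lexx ?big_ord1. Qed.

Definition weight1 : simplex R 1 := exist (fun t => t \in simplex R 1) _ weight1_subproof.

Lemma weight2_subproof c : 0 <= c <= 1 ->
  (fun i : 'I_2 => if i == ord0 then c else 1 - c) \in simplex R 2.
Proof.
move=> c01; apply: mem_set; split=> [i|]; last first.
  by rewrite big_ord_recl big_ord1 /= addrC subrK.
by case: ifP => _ //; lra.
Qed.

Definition weight2 c (c01 : 0 <= c <= 1) : simplex R 2 :=
  exist (fun t => t \in simplex R 2) _ (weight2_subproof c01).

Definition two_point a b c (c01 : 0 <= c <= 1) : fmeasure R X :=
  dirac_sum (fun i : 'I_2 => if i == ord0 then a else b) (weight2 c01).

Lemma two_point_swap a b c c' (c01 : 0 <= c <= 1) (c01' : 0 <= c' <= 1) :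
  c' = 1 - c -> two_point a b c01 = two_point b a c01'.
Proof.
move=> cc'; apply/dirac_sum_eq/rst_step.
rewrite (_ : (fun i => if i == ord0 then b else a) =
  (fun i => if i == ord0 then a else b) \o (tperm ord0 ord_max : 'S_2)).
  apply: wstep_perm => i /=; rewrite cc'.
  have [->|i0] := eqVneq i ord0; first by rewrite tpermL.
  have -> : i = ord_max by apply/val_inj; case: i i0 => -[|[]].
  by rewrite tpermR /= opprB addrC subrK.
apply/funext => i /=.
have [->|i0] := eqVneq i ord0; first by rewrite tpermL.
have -> : i = ord_max by apply/val_inj; case: i i0 => -[|[]].
by rewrite tpermR.
Qed.

Lemma two_point1 a b c (c01 : 0 <= c <= 1) :
  c = 1 -> two_point a b c01 = dirac_sum (fun=> a) weight1.
Proof.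
move=> c1; apply/dirac_sum_eq/rst_step.
rewrite (_ : (fun=> a) =
  (fun i => if i == ord0 then a else b) \o @winit 0); last first.
  by apply/funext => i; rewrite ord1.
by apply: wstep_drop => [|i] /=; rewrite ?c1 ?subrr // ord1.
Qed.

Lemma two_point_diag a c (c01 : 0 <= c <= 1) :
  two_point a a c01 = dirac_sum (fun=> a) weight1.
Proof.
apply/dirac_sum_eq/rst_step.
rewrite (_ : (fun=> a) =
  (fun i => if i == ord0 then a else a) \o @winit 0); last first.
  by apply/funext => i; rewrite ord1.
by apply: wstep_merge => [//|i] /=; rewrite ord1 /= addrC subrK.
Qed.

Lemma eq_two_point a b a' b' c c' (c01 : 0 <= c <= 1) (c01' : 0 <= c' <= 1) :
  c = c' -> (c != 0 -> a = a') -> (c != 1 -> b = b') ->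
  two_point a b c01 = two_point a' b' c01'.
Proof.
move=> cc'; subst c'; rewrite (bool_irrelevance c01' c01) => aa' bb'.
have [c1|/bb' {}bb'] := eqVneq c 1.
  by rewrite !two_point1 // aa' // c1 oner_neq0.
have [c0|/aa' {}aa'] := eqVneq c 0; last by rewrite aa' bb'.
have h : 0 <= 1 - c <= 1 by lra.
rewrite (two_point_swap a b c01 h erefl).
rewrite (two_point_swap a' b' c01 h erefl).
by rewrite !two_point1 ?bb' // c0 subr0.
Qed.

Lemma supp_two_point_sub a b c (c01 : 0 <= c <= 1) :
  supp (two_point a b c01) `<=` [set a; b].
Proof.
move=> p /supp_dirac_sum_sub[i <- _]; case: ifP => _; by [left|right].
Qed.

(** A point of the support comes with a reduced form, whence the separate cases of a zero weight and
    of coinciding atoms. *)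
Lemma supp_two_point_neq0 a b c (c01 : 0 <= c <= 1) :
  supp (two_point a b c01) !=set0.
Proof.
have supp1 p : supp (dirac_sum (fun=> p) weight1) p.
  rewrite supp_dirac_sum //=; last by move=> i j _; rewrite !ord1.
  by exists ord0.
have [c1|c1] := eqVneq c 1; first by exists a; rewrite two_point1.
have [c0|c0] := eqVneq c 0.
  have h : 0 <= 1 - c <= 1 by lra.
  rewrite (two_point_swap a b c01 h erefl).
  by exists b; rewrite two_point1 // c0 subr0.
have [ab|/eqP ab] := pselect (a = b).
  by exists a; rewrite -ab two_point_diag.
exists a; rewrite supp_dirac_sum; first by exists ord0.
- move=> i j; case: (eqVneq i ord0) => [->|i0]; case: (eqVneq j ord0) => [->|j0] //.
  + by move=> abE; case/eqP: ab.
  + by move=> abE; case/eqP: ab.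
  + by move=> _; apply/val_inj; case: i i0 j j0 => -[|[]]// ? ? [] [|[]].
- move=> i /=; move: c0 c1 => /eqP c0 /eqP c1.
  by case: ifP => _; rewrite lt_neqAle; apply/andP; split; try lra;
    apply/eqP; lra.
Qed.

Lemma fmeasure_le_two_point a b c (c01 : 0 <= c <= 1) :
  fmeasure_le 2 (two_point a b c01).
Proof.
rewrite /fmeasure_le /=.
apply: card_le_trans (card_image_le (fun n => if n == 0%N then a else b) `I_2).
apply: subset_card_le => p /supp_two_point_sub[->|->]; by [exists 0%N|exists 1%N].
Qed.

(** Tuples live in a kified product; compactness of [Z] makes the map into it continuous, and the
    quotient map does the rest. *)
Lemma continuous_two_point (Z : topologicalType) (a b : Z -> X) (c : Z -> R)
    (c01 : forall z, 0 <= c z <= 1) :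
  compact [set: Z] -> continuous a -> continuous b -> continuous c ->
  continuous (fun z => two_point (a z) (b z) (c01 z)).
Proof.
move=> cZ ca cb cc.
pose F z : ({ptws 'I_2 -> X} * simplex R 2)%type :=
  (fun i => if i == ord0 then a z else b z, weight2 (c01 z)).
have cF : continuous F.
  apply: (@continuous_pair Z {ptws 'I_2 -> X} (simplex R 2)
    (fun z i => if i == ord0 then a z else b z) (fun z => weight2 (c01 z))).
    by apply: continuous_ptws => i; case: (i == ord0).
  have cw (i : 'I_2) : continuous (fun z => if i == ord0 then c z else 1 - c z).
    case: (i == ord0) => // z; apply: cvgB; [exact: cvg_cst|exact: cc].
  apply: continuous_comp_initial; apply: continuous_ptws => i; exact: cw.
have ckF := continuous_to_kification cZ cF.
have cw : continuous (fun z => mkwtuple (F z).1 (F z).2 : wtuple R X).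
  move=> z; apply: (continuous_comp (ckF z)).
  exact: (@existT_continuous nat (fun n =>
    kification ({ptws 'I_n.+1 -> X} * simplex R n.+1)%type) 1%N).
move=> z; apply: (continuous_comp (cw z)).
exact: pi_continuous.
Qed.

End two_point.

(** * The Euclidean inner product *)

Section dot.
Variables (R : realType) (n : nat).
Implicit Types x y z : 'rV[R]_n.

Definition dot x y : R := \sum_i x 0 i * y 0 i.

Lemma dotC x y : dot x y = dot y x.
Proof. by apply: eq_bigr => i _; rewrite mulrC. Qed.

Lemma dotDl x y z : dot (x + y) z = dot x z + dot y z.
Proof. by rewrite -big_split; apply: eq_bigr => i _; rewrite mxE mulrDl. Qed.

Lemma dotZl a x y : dot (a *: x) y = a * dot x y.
Proof. by rewrite big_distrr /=; apply: eq_bigr => i _; rewrite mxE mulrA. Qed.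

Lemma dotDr x y z : dot x (y + z) = dot x y + dot x z.
Proof. by rewrite dotC dotDl !(dotC x). Qed.

Lemma dotZr a x y : dot x (a *: y) = a * dot x y.
Proof. by rewrite dotC dotZl dotC. Qed.

Lemma dotNl x y : dot (- x) y = - dot x y.
Proof. by rewrite -scaleN1r dotZl mulN1r. Qed.

Lemma dotNr x y : dot x (- y) = - dot x y.
Proof. by rewrite dotC dotNl dotC. Qed.

Lemma dot_ge0 x : 0 <= dot x x.
Proof. by apply: sumr_ge0 => i _; rewrite -expr2 sqr_ge0. Qed.

Lemma dot_eq0 x : dot x x = 0 -> x = 0.
Proof.
move=> /eqP; rewrite psumr_eq0 => [/allP x0|i _]; last by rewrite -expr2 sqr_ge0.
apply/rowP => i; rewrite mxE; apply/eqP; rewrite -sqrf_eq0 expr2.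
by have /implyP := x0 i (mem_index_enum _); exact.
Qed.

Lemma continuous_dot (T : topologicalType) (f g : T -> 'rV[R]_n) :
  continuous f -> continuous g -> continuous (fun t => dot (f t) (g t)).
Proof.
move=> cf cg; apply: continuous_big => [|i _ t].
  by move=> -[a b]; exact: add_continuous.
apply: cvgM.
- exact: (continuous_comp (cf t) (@coord_continuous _ _ _ 0 i (f t))).
- exact: (continuous_comp (cg t) (@coord_continuous _ _ _ 0 i (g t))).
Qed.

End dot.

(** * Projective space: unit representatives, separation, compactness *)

Section projective_space.
Variables (R : realType) (d : nat).
Local Notation V := 'rV[R]_d.+1.
Implicit Types x y : V.

Lemma sphereE x : @sphere R d x <-> dot x x = 1.
Proof. by []. Qed.

Lemma dot_val (x : @sphere R d) : dot (val x) (val x) = 1.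
Proof. exact/sphereE/(set_valP x). Qed.

Lemma dot_delta (i j : 'I_d.+1) :
  dot (delta_mx 0 i : V) (delta_mx 0 j) = (i == j)%:R.
Proof.
rewrite /dot (bigD1 i) //= big1 ?addr0 => [|k ki].
  by rewrite !mxE !eqxx mul1r.
by rewrite !mxE (negPf ki) !andbF mul0r.
Qed.

Lemma pole_subproof : (delta_mx 0 0 : V) \in @sphere R d.
Proof. by apply/mem_set/sphereE; rewrite dot_delta eqxx. Qed.

Definition pole : @sphere R d := exist (fun x => x \in @sphere R d) _ pole_subproof.

(** Total on vectors, with the class of [pole] as default value off the sphere; lemmas about [rp x]
    therefore assume that [x] is a unit vector. *)
Definition rp x : RP R d := \pi_(RP R d) (insubd pole x).

Lemma val_insubd_pole x : dot x x = 1 -> val (insubd pole x) = x.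
Proof. by move=> /sphereE x1; rewrite insubdK //; exact: mem_set. Qed.

Lemma rp_surj (q : RP R d) : exists2 x, dot x x = 1 & rp x = q.
Proof.
exists (val (repr q)); first exact: dot_val.
by rewrite /rp valKd reprK.
Qed.

Lemma rp_eq x y : dot x x = 1 -> dot y y = 1 ->
  rp x = rp y <-> x = y \/ x = - y.
Proof.
move=> x1 y1; split.
  move=> /eqmodP /=; rewrite /antipodal !val_insubd_pole //.
  by case/orP => /eqP; [left|right].
move=> xy; apply/eqmodP; rewrite /= /antipodal !val_insubd_pole //.
by apply/orP; case: xy => ->; rewrite eqxx; [left|right].
Qed.

Lemma rpN x : dot x x = 1 -> rp (- x) = rp x.
Proof. by move=> x1; apply/rp_eq; rewrite ?dotNl ?dotNr ?opprK //; right. Qed.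

Lemma continuous_rp (T : topologicalType) (f : T -> V) :
  continuous f -> (forall t, dot (f t) (f t) = 1) ->
  continuous (fun t => rp (f t)).
Proof.
move=> cf f1.
pose h t : @sphere R d :=
  exist (fun x => x \in @sphere R d) (f t) (mem_set ((sphereE _).2 (f1 t))).
have -> : (fun t => rp (f t)) = \pi_(RP R d) \o h.
  by apply/funext => t /=; congr (\pi); apply: val_inj; rewrite val_insubd_pole.
have ch : continuous h by exact: continuous_comp_initial.
by move=> t; apply: (continuous_comp (ch t)); exact: pi_continuous.
Qed.

(* [entry i j [x]] is the [(i, j)] entry of the projection onto the line
   through [x]. *)
Definition entry (i j : 'I_d.+1) (q : RP R d) : R :=
  val (repr q) 0 i * val (repr q) 0 j.

Lemma entry_rp i j x : dot x x = 1 -> entry i j (rp x) = x 0 i * x 0 j.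
Proof.
move=> x1; have y1 : dot (val (repr (rp x))) (val (repr (rp x))) = 1.
  exact: dot_val.
have : rp (val (repr (rp x))) = rp x by rewrite {1}/rp valKd reprK.
by rewrite /entry => /rp_eq[]// ->; rewrite // !mxE mulrNN.
Qed.

Lemma continuous_entry i j : continuous (entry i j).
Proof.
apply/quotient_continuous.
have -> : entry i j \o \pi_(RP R d) =
    (fun x : @sphere R d => val x 0 i * val x 0 j).
  apply/funext => x /=; rewrite -entry_rp; last exact: dot_val.
  by rewrite /rp valKd.
have cv k : continuous (fun x : @sphere R d => val x 0 k).
  move=> x; apply: (@continuous_comp (@sphere R d) V R val (fun M => M 0 k)).
    exact: initial_continuous.
  exact: coord_continuous.
by move=> x; exact: (continuousM (cv i x) (cv j x)).
Qed.

(** Contracting x_i x_j = y_i y_j with [x] gives x = <x, y> y, and unit length then forces <x, y> to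
    be 1 or -1. *)
Lemma entry_inj (p q : RP R d) : (forall i j, entry i j p = entry i j q) -> p = q.
Proof.
have [x x1 <-] := rp_surj p; have [y y1 <-] := rp_surj q => xy.
have xE : x = dot x y *: y.
  apply/rowP => j; rewrite mxE -[LHS]mul1r -x1 !big_distrl /=.
  by apply: eq_bigr => i _; rewrite -mulrA -entry_rp // xy entry_rp // mulrA.
apply/rp_eq => //.
have : (dot x y - 1) * (dot x y + 1) = 0.
  rewrite -subr_sqr expr1n; apply/eqP; rewrite subr_eq0; apply/eqP.
  by rewrite -[RHS]x1 [in RHS]xE dotZl dotZr y1 mulr1.
move/eqP; rewrite mulf_eq0 subr_eq0 addr_eq0 => /orP[]/eqP xyE;
  rewrite xE xyE; [left|right]; by rewrite ?scale1r ?scaleN1r.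
Qed.

(** The entries of the projection matrix are continuous real functions that separate lines. *)
Lemma hausdorff_RP : hausdorff_space (RP R d).
Proof.
move=> p q pq; apply: entry_inj => i j.
exact: (cluster_continuous (@Rhausdorff R) (@continuous_entry i j) pq).
Qed.

Lemma compact_sphere : compact (@sphere R d).
Proof.
have cD : continuous (fun x : V => dot x x) by apply: continuous_dot => x; exact: cvg_id.
have cl : closed (@sphere R d).
  have -> : @sphere R d = (fun x : V => dot x x) @^-1` [set 1].
    by apply/seteqP; split=> x /sphereE.
  move/continuous_closedP : cD; apply.
  by apply: accessible_closed_set1; apply: hausdorff_accessible; exact: Rhausdorff.
have cB := @rV_compact R d.+1 (fun=> `[-1, 1]%classic) (fun=> @segment_compact R _ _).
apply: (subclosed_compact cl cB) => x /sphereE x1 i /=.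
rewrite in_itv /=.
have : x 0 i ^+ 2 <= 1.
  rewrite -x1 /dot (bigD1 i) //= -expr2 lerDl sumr_ge0 // => j _.
  by rewrite -expr2 sqr_ge0.
by move=> xi; nra.
Qed.

Lemma compact_RP : compact [set: RP R d].
Proof.
have -> : [set: RP R d] = \pi_(RP R d) @` [set: @sphere R d].
  by apply/seteqP; split=> // q _; exists (repr q); rewrite ?reprK.
apply: continuous_compact; last exact: compact_set_type compact_sphere.
by apply: continuous_subspaceT; exact: pi_continuous.
Qed.

End projective_space.

(** * The path space and the exponential law *)

Section paths.
Variables (R : realType) (X : topologicalType).
Local Notation I := (unit_interval R).

Definition path_at (g : pathspace R X) (u : I) : X := (g : continuousType I X) u.

Lemma path_ext (g h : pathspace R X) : path_at g =1 path_at h -> g = h.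
Proof. by move=> gh; apply/continuousEP. Qed.

Lemma compact_unit_interval : compact [set: I].
Proof. by apply: compact_set_type; exact: segment_compact. Qed.

Lemma hausdorff_unit_interval : hausdorff_space I.
Proof.
move=> u v uv; apply: val_inj.
apply: (cluster_continuous (@Rhausdorff R) _ uv); exact: initial_continuous.
Qed.

Lemma path_curry (Z : topologicalType) (h : Z * I -> X) : continuous h ->
  exists2 p : Z -> pathspace R X, continuous p &
    forall z u, path_at (p z) u = h (z, u).
Proof.
move=> /continuous_curry[ch chz].
exists (fun z => mkcts (chz z)) => //.
exact: continuous_comp_initial.
Qed.

(** Evaluation is jointly continuous because the unit interval is locally compact and Hausdorff. *)
Lemma continuous_path_at (Z : topologicalType) (p : Z -> pathspace R X) :
  continuous p -> continuous (fun zu : Z * I => path_at (p zu.1) zu.2).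
Proof.
move=> cp.
have lc : locally_compact [set: I].
  move=> u _; exists setT; first exact: filterT.
  by split; [exact: compact_unit_interval|exact: closedT].
have cf : continuous (fun z => path_at (p z) : {compact-open, I -> X}).
  move=> z; apply: (continuous_comp (cp z)); exact: initial_continuous.
have := continuous_uncurry lc hausdorff_unit_interval cf
  (fun z => @cts_fun _ _ (p z : continuousType I X)).
have -> // : uncurry (fun z => path_at (p z)) = (fun zu : Z * I => path_at (p zu.1) zu.2).
by apply/funext => -[].
Qed.

End paths.

(** * Orthogonal projection onto a line *)

Section line_projection.
Variables (R : realType) (d : nat).
Local Notation V := 'rV[R]_d.+1.

(** The orthogonal projection of [v] onto the line [q], written with [entry] so that it is visibly
    continuous in [q], without choosing a unit vector on the line. *)
Definition line_proj (q : RP R d) (v : V) : V := \row_j \sum_i v 0 i * entry i j q.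

Lemma line_proj_rp (x v : V) : dot x x = 1 -> line_proj (rp x) v = dot v x *: x.
Proof.
move=> x1; apply/rowP => j; rewrite !mxE big_distrl /=.
by apply: eq_bigr => i _; rewrite entry_rp // mulrA.
Qed.

(* The squared cosine of the angle between two lines. *)
Definition cos2 (p q : RP R d) : R := \sum_i \sum_j entry i j p * entry i j q.

Lemma cos2_rp (x y : V) : dot x x = 1 -> dot y y = 1 ->
  cos2 (rp x) (rp y) = dot x y ^+ 2.
Proof.
move=> x1 y1; rewrite expr2 {1}/dot big_distrl; apply: eq_bigr => i _ /=.
rewrite big_distrr; apply: eq_bigr => j _ /=.
by rewrite !entry_rp // mulrACA.
Qed.

Lemma continuous_cos2 (T : topologicalType) (f g : T -> RP R d) :
  continuous f -> continuous g -> continuous (fun t => cos2 (f t) (g t)).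
Proof.
move=> cf cg.
apply: continuous_big => [|i _]; first by move=> -[a b]; exact: add_continuous.
apply: continuous_big => [|j _ t]; first by move=> -[a b]; exact: add_continuous.
apply: (@continuousM _ _ (fun t => entry i j (f t)) (fun t => entry i j (g t))).
- exact: (continuous_comp (cf t) (@continuous_entry R d i j (f t))).
- exact: (continuous_comp (cg t) (@continuous_entry R d i j (g t))).
Qed.

End line_projection.

(** * Half a great circle gives a noncontractible loop *)

Section no_contraction.
Variables (R : realType) (d : nat).
Local Notation V := 'rV[R]_d.+1.
Local Notation I := (unit_interval R).

(** A line has [cos2] equal to 1 with itself, hence nonzero with nearby lines, and compactness of
    the square makes the mesh uniform. Consecutive lines of a subdivision are then never orthogonal,
    so projecting from one to the next kills no nonzero vector. *)
Lemma uniform_mesh (h : R * I -> RP R d) : continuous h ->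
  exists N : nat, forall (r : R) (u v : I), 0 <= r <= 1 ->
    `|val u - val v| <= N.+1%:R^-1 -> cos2 (h (r, u)) (h (r, v)) != 0.
Proof.
move=> ch.
have cK : compact (`[0, 1]%classic `*` setT : set (R * I)%type).
  exact: compact_setX (@segment_compact R 0 1) (@compact_unit_interval R).
pose P (N : nat) (ru : R * I) := forall v : I,
  `|val ru.2 - val v| <= N.+1%:R^-1 -> cos2 (h ru) (h (ru.1, v)) != 0.
(* Compactness as near covering: it suffices that around each point [P N] holds for all large [N];
   one [N] then serves the whole square. *)
have [r0u0 _|N _ /(_ N (leqnn N)) NP] :=
  (compact_near_coveringP _).1 cK nat \oo P _; last first.
  exists N => r u v r01 uv; by apply: (NP (r, u)).
case: r0u0 => r0 u0.
have cS : continuous (fun w : (R * I) * I => cos2 (h w.1) (h (w.1.1, w.2))).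
  apply: continuous_cos2 => w; apply: continuous_comp.
  - exact: cvg_fst.
  - exact: ch.
  - apply: (@continuous_pair _ _ _ (fun w => w.1.1) (fun w => w.2)).
      move=> w'; apply: (continuous_comp (@cvg_fst _ _ _ _ _)); exact: cvg_fst.
    move=> w'; exact: cvg_snd.
  - exact: ch.
have : nbhs (cos2 (h (r0, u0)) (h (r0, u0))) [set s : R | s != 0].
  apply: open_nbhs_nbhs; split; first exact: open_neq.
  rewrite /=; have [x x1 <-] := rp_surj (h (r0, u0)).
  by rewrite cos2_rp // x1 expr1n oner_neq0.
move=> /(cS ((r0, u0), u0))[[A B] /= [nA [W [[W' oW' <-] /= W'u0] WB]]] AB.
have /nbhs_ballP[e /= e0 eW'] := open_nbhs_nbhs (conj oW' W'u0).
(* Half of the radius bounds the distance from [u0] to [u], the other half the distance from [u] to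
   [v]. *)
have e20 : 0 < e / 2 by rewrite divr_gt0.
have nu : \forall u \near u0, `|val u0 - val u| < e / 2.
  have : nbhs (val u0) (ball (val u0) (e / 2)).
    exact: nbhsx_ballx.
  by move/(@initial_continuous _ _ (val : I -> R) u0).
near=> ru N => v uv.
have Aru : A ru by near: ru.
apply: (AB (ru, v)); split => //=; apply: WB; apply: eW'.
rewrite /ball /=.
have ru2 : `|val u0 - val ru.2| < e / 2.
  by near: ru; apply: cvg_snd nu.
have N2 : N.+1%:R^-1 < e / 2 by near: N; exact: (near_infty_natSinv_lt (PosNum e20)).
rewrite [e]splitr; apply: le_lt_trans (ler_distD (val ru.2) _ _) _.
by apply: ltrD => //; exact: le_lt_trans uv N2.
Unshelve. all: by end_near.
Qed.

(* A contraction of the loop [rp \o X] would lift, through successive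
   projections onto the lines [h (r, k / N)], to a continuous family of nonzero
   vectors [v N r] on the line through [X r]. *)
Lemma no_contraction (x0 : V) (X : R -> V) (h : R * I -> RP R d) :
  dot x0 x0 = 1 -> (forall r, dot (X r) (X r) = 1) ->
  (forall j, continuous (fun r => X r 0 j)) -> continuous h ->
  X 1 = - X 0 -> (forall u, h (1, u) = h (0, u)) ->
  (forall r, h (r, unit0 R) = rp x0) ->
  (forall r, h (r, unit1 R) = rp (X r)) -> False.
Proof.
move=> x01 X1 cX ch X01 h01 h0 h1.
have [N mesh] := uniform_mesh ch.
pose u k : I := insubd (unit0 R) (k%:R / N.+1%:R).
have uE k : (k <= N.+1)%N -> val (u k) = k%:R / N.+1%:R.
  move=> kN; rewrite insubdK //; apply: mem_set; rewrite /= in_itv /=.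
  by rewrite divr_ge0 //= ler_pdivrMr // mul1r ler_nat.
have u0E : u 0%N = unit0 R by apply: val_inj; rewrite uE //= mul0r.
have u1E : u N.+1 = unit1 R by apply: val_inj; rewrite uE //= divff // pnatr_eq0.
pose v := fix v k r := if k is k'.+1 then line_proj (h (r, u k)) (v k' r) else x0.
have cv k j : continuous (fun r => v k r 0 j).
  elim: k j => [|k IH] j /=; first exact: cst_continuous.
  have -> : (fun r => line_proj (h (r, u k.+1)) (v k r) 0 j) =
      (fun r => \sum_i v k r 0 i * entry i j (h (r, u k.+1))).
    by apply/funext => r; rewrite mxE.
  apply: continuous_big => [|i _ r]; first by move=> -[a b]; exact: add_continuous.
  apply: (@continuousM _ _ (fun r => v k r 0 i)
    (fun r => entry i j (h (r, u k.+1)))); first exact: IH.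
  have cr : continuous (fun r : R => (r, u k.+1)).
    by apply: continuous_pair => [s|]; [exact: cvg_id|exact: cst_continuous].
  apply: (@continuous_comp _ _ _ (fun r => h (r, u k.+1)) (entry i j)).
    exact: (continuous_comp (cr r) (ch _)).
  exact: continuous_entry.
(* Invariant: [v k r] is a nonzero vector on the line [h (r, u k)]. Each projection multiplies its
   coordinate by [dot y z], whose square is the [cos2] of consecutive lines. *)
have vP r k : 0 <= r <= 1 -> (k <= N.+1)%N -> exists c y,
    [/\ c != 0, dot y y = 1, h (r, u k) = rp y & v k r = c *: y].
  move=> r01; elim: k => [_|k IH kN].
    by exists 1, x0; rewrite oner_neq0 u0E h0 scale1r.
  have [c [y [c0 y1 hy vk]]] := IH (ltnW kN).
  have [z z1 hz] := rp_surj (h (r, u k.+1)).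
  exists (c * dot y z), z; rewrite -hz /= -hz line_proj_rp // vk dotZl.
  split=> //; rewrite mulf_neq0 // -sqrf_eq0 -cos2_rp // -hy hz.
  apply: mesh => //; rewrite !uE //; last exact: ltnW.
  by rewrite -mulrBl -natr1 opprD addrA subrr add0r mulN1r normrN ger0_norm //.
pose F r := dot (v N.+1 r) (X r).
have F0 r : 0 <= r <= 1 -> F r != 0.
  move=> r01; have [c [y [c0 y1 hy vy]]] := vP r N.+1 r01 (leqnn _).
  rewrite /F vy dotZl mulf_neq0 //.
  move: hy; rewrite u1E h1 => /rp_eq[]// ->.
    by rewrite y1 oner_neq0.
  by rewrite dotNr y1 oppr_eq0 oner_neq0.
have cF : continuous F.
  apply: continuous_big => [|i _ r]; first by move=> -[a b]; exact: add_continuous.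
  exact: (continuousM (cv N.+1 i r) (cX i r)).
(* The construction sees [r] only through [h (r, _)], so [v] closes up while [X] changes sign. Hence
   [F] changes sign too, against [F0]. *)
have v01 k : v k 1 = v k 0 by elim: k => //= k ->; rewrite h01.
have F1 : F 1 = - F 0 by rewrite /F v01 X01 dotNr.
have [|r r01 Fr] := @IVT R F 0 1 0 ler01 (continuous_subspaceT cF).
  rewrite F1 ge_min le_max oppr_le0 oppr_ge0.
  by have [_|/ltW ->] := lerP 0 (F 0); rewrite ?orbT.
by move: r01; rewrite in_itv /= => /F0; rewrite Fr eqxx.
Qed.

End no_contraction.

(** * Great arcs on the sphere *)

Section arcs.
Variables (R : realType) (d : nat).
Local Notation V := 'rV[R]_d.+1.
Local Notation I := (unit_interval R).
Implicit Types (x y v w : V) (a e : R).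

Definition orthopair x v : Prop := [/\ dot x x = 1, dot v v = 1 & dot x v = 0].

Definition great_arc x v a : V := cos a *: x + sin a *: v.

Lemma great_arc0 x v : great_arc x v 0 = x.
Proof. by rewrite /great_arc cos0 sin0 scale1r scale0r addr0. Qed.

Lemma orthopairN x v : orthopair x v -> orthopair x (- v).
Proof. by move=> [x1 v1 xv]; split; rewrite ?dotNl ?dotNr ?opprK ?xv ?oppr0. Qed.

Lemma dot_arc x v a : orthopair x v -> dot (great_arc x v a) (great_arc x v a) = 1.
Proof.
move=> [x1 v1 xv].
rewrite dotDl !dotDr !dotZl !dotZr x1 v1 (dotC v) xv !mulr0 addr0 add0r !mulr1.
by rewrite -!expr2 cos2Dsin2.
Qed.

Lemma dot_arcl x v a : orthopair x v -> dot x (great_arc x v a) = cos a.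
Proof. by move=> [x1 v1 xv]; rewrite dotDr !dotZr x1 xv mulr0 addr0 mulr1. Qed.

(** Leaving [x] in the opposite direction, the supplementary angle leads to the antipode of the
    endpoint: this is the second arc between the same two lines. *)
Lemma great_arc_supplement x v a : great_arc x (- v) (pi - a) = - great_arc x v a.
Proof.
rewrite /great_arc cosB sinB cospi sinpi !mul0r addr0 sub0r !mulN1r opprK.
by rewrite opprD scaleNr scalerN.
Qed.

Lemma continuous_arc (T : topologicalType) (f g : T -> V) (a : T -> R) :
  continuous f -> continuous g -> continuous a ->
  continuous (fun t => great_arc (f t) (g t) (a t)).
Proof.
move=> cf cg ca t; apply: cvgD; apply: cvgZ => //.
- exact: (continuous_comp (ca t) (@continuous_cos R (a t))).
- exact: cf.
- exact: (continuous_comp (ca t) (@continuous_sin R (a t))).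
- exact: cg.
Qed.

(** Here [e] is a common sign change of both end vectors. The angle is the arccosine of their inner
    product. If its sine is nonzero, the endpoints determine the direction [v]; otherwise
    [cos a != - 1] leaves only [a = 0] and a constant arc. *)
Lemma rp_arc_eq x v x' v' a a' e : e ^+ 2 = 1 ->
  orthopair x v -> orthopair x' v' -> 0 <= a <= pi -> 0 <= a' <= pi ->
  x' = e *: x -> great_arc x' v' a' = e *: great_arc x v a ->
  a' = a /\
  (cos a != - 1 -> forall u, rp (great_arc x' v' (a' * u)) = rp (great_arc x v (a * u))).
Proof.
move=> e2 xv xv' a0 a0' xe ye.
have aE : a' = a.
  apply: cos_inj; rewrite ?in_itv //=.
  by rewrite -(dot_arcl a' xv') -(dot_arcl a xv) ye xe dotZl dotZr mulrA -expr2 e2 mul1r.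
split=> // ca u; rewrite aE.
have e1 : e = 1 \/ e = - 1.
  by move/eqP: e2; rewrite sqrf_eq1 => /orP[]/eqP ->; [left|right].
apply/rp_eq; [exact: dot_arc|exact: dot_arc|].
suff -> : great_arc x' v' (a * u) = e *: great_arc x v (a * u).
  by case: e1 => ->; rewrite ?scale1r ?scaleN1r; [left|right].
have [s0|s0] := eqVneq (sin a) 0.
  have /eqP : cos a ^+ 2 = 1 by rewrite cos2sin2 s0 expr0n subr0.
  rewrite sqrf_eq1 (negPf ca) orbF => /eqP c1.
  have -> : a = 0.
    by apply: cos_inj; rewrite ?in_itv //= ?lexx ?pi_ge0 // c1 cos0.
  by rewrite mul0r !great_arc0.
move: ye; rewrite /great_arc aE xe !scalerDr !scalerA (mulrC (cos a)) => /addrI.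
rewrite (mulrC e) => sv.
have -> : v' = e *: v.
  by rewrite -[v']scale1r -(mulVf s0) -scalerA sv scalerA mulrA mulVf // mul1r.
by rewrite scalerA (mulrC (cos _)) (mulrC (sin _)).
Qed.

(** Pythagoras for the component of [y] orthogonal to [x]: nonnegativity yields Cauchy-Schwarz, and
    vanishing yields the degenerate case of [arc_surj]. *)
Lemma dot_sub_proj x y : dot x x = 1 -> dot y y = 1 ->
  dot (y - dot x y *: x) (y - dot x y *: x) = 1 - dot x y ^+ 2.
Proof.
move=> x1 y1; rewrite dotDl !dotDr !dotNl !dotNr !dotZl !dotZr x1 y1 (dotC y).
by ring.
Qed.

Lemma dot_le1 x y : dot x x = 1 -> dot y y = 1 -> dot x y ^+ 2 <= 1.
Proof. by move=> x1 y1; rewrite -subr_ge0 -dot_sub_proj // dot_ge0. Qed.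

(** One Gram-Schmidt step; the last hypothesis excludes that [y] is [x] or [- x], so the
    normalization divides by a nonzero length. *)
Lemma orthopair_complete x y : dot x x = 1 -> dot y y = 1 -> dot x y ^+ 2 != 1 ->
  exists2 v, orthopair x v &
    y = dot x y *: x + Num.sqrt (1 - dot x y ^+ 2) *: v.
Proof.
move=> x1 y1 xy; have xy1 := dot_le1 x1 y1.
set c := dot x y in xy xy1 *.
have c0 : 0 < 1 - c ^+ 2 by rewrite subr_gt0 lt_neqAle xy.
have s0 : Num.sqrt (1 - c ^+ 2) != 0 by rewrite gt_eqF // sqrtr_gt0.
exists ((Num.sqrt (1 - c ^+ 2))^-1 *: (y - c *: x)).
  split=> //.
    rewrite dotZl dotZr mulrA -expr2 exprVn sqr_sqrtr ?ltW // dot_sub_proj //.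
    by rewrite mulVf // gt_eqF.
  by rewrite dotZr dotDr dotNr dotZr x1 mulr1 subrr mulr0.
by rewrite scalerA divff // scale1r addrC subrK.
Qed.

(** If all coordinates had square 1, the squared length would be d + 1 > 1. So some basis vector is
    not [x] up to sign, and Gram-Schmidt applies to it. *)
Lemma exists_orthopair x : (0 < d)%N -> dot x x = 1 -> exists v, orthopair x v.
Proof.
move=> d0 x1.
have [i xi] : exists i, x 0 i ^+ 2 != 1.
  apply: contrapT => /forallNP h.
  have xi i : x 0 i ^+ 2 = 1 by have /negP := h i; rewrite negbK => /eqP.
  have : dot x x = d.+1%:R.
    rewrite /dot; under eq_bigr do rewrite -expr2 xi.
    by rewrite sumr_const card_ord.
  by rewrite x1 => /eqP; rewrite eq_sym (eqr_nat R d.+1 1) eqSS gtn_eqF.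
have dx : dot x (delta_mx 0 i) = x 0 i.
  rewrite /dot (bigD1 i) //= big1 ?addr0 => [|k ki].
    by rewrite !mxE !eqxx mulr1.
  by rewrite !mxE (negPf ki) andbF mulr0.
have [|||v xv _] := @orthopair_complete x (delta_mx 0 i) => //.
- by rewrite dot_delta eqxx.
- by rewrite dx.
- by exists v.
Qed.

(** The angle is the arccosine of [dot x y]. When [y] is [x] or [- x] any orthogonal unit vector
    serves as direction, and its existence rests on [d > 0]. *)
Lemma arc_surj x y : (0 < d)%N -> dot x x = 1 -> dot y y = 1 ->
  exists v a, [/\ orthopair x v, 0 <= a <= pi & great_arc x v a = y].
Proof.
move=> d0 x1 y1.
have c1 : -1 <= dot x y <= 1.
  have := dot_le1 x1 y1.
  by rewrite -real_normK ?num_real // expr_le1 ?normr_ge0 // ler_norml.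
have a0 : 0 <= acos (dot x y) <= pi by rewrite acos_ge0 ?acos_lepi.
have [c2|c2] := eqVneq (dot x y ^+ 2) 1; last first.
  have [v xv yE] := orthopair_complete x1 y1 c2.
  exists v, (acos (dot x y)); split=> //.
  by rewrite /great_arc acosK ?in_itv // sin_acos // -yE.
have [v xv] := exists_orthopair d0 x1.
exists v, (acos (dot x y)); split=> //.
rewrite /great_arc acosK ?in_itv // sin_acos // c2 subrr sqrtr0 scale0r addr0.
apply/eqP; rewrite eq_sym -subr_eq0; apply/eqP/dot_eq0.
by rewrite dot_sub_proj // c2 subrr.
Qed.

End arcs.

(** * Lower bound: one-point supports do not suffice *)

Section lower_bound.
Variables (R : realType) (d : nat).
Local Notation V := 'rV[R]_d.+1.
Local Notation I := (unit_interval R).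

Lemma compact_RP2 : compact [set: RP R d * RP R d].
Proof.
rewrite -setXTT; exact: compact_setX (@compact_RP R d) (@compact_RP R d).
Qed.

Lemma not_asecat_bound0_RP : (0 < d)%N ->
  ~ asecat_bound R (@path_endpoints R (RP R d)) 0.
Proof.
move=> d0 /asecat_bound0_section[g cg gE].
pose e0 : V := delta_mx 0 0; pose e1 : V := delta_mx 0 ord_max.
have e01 : orthopair e0 e1.
  split; rewrite dot_delta ?eqxx // -val_eqE /=.
  by rewrite eq_sym gtn_eqF.
pose X (r : R) : V := great_arc e0 e1 (pi * r).
have cpi : continuous (fun r : R => pi * r).
  move=> r; exact: (continuousM (@cst_continuous _ _ pi r) (@cvg_id _ _)).
have cX : continuous X by apply: continuous_arc => //; exact: cst_continuous.
have X1 r : dot (X r) (X r) = 1 by exact: dot_arc.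
have [e0e0 _ _] := e01.
pose b (r : R) : (RP R d * RP R d)%type := (rp e0, rp (X r)).
have cb : continuous b.
  apply: continuous_pair; first exact: cst_continuous.
  exact: continuous_rp.
(* The source [R] of the loop is not compact, so the kified product is reached through the compact
   product of projective spaces. *)
have ck : continuous (id : RP R d * RP R d -> kification (RP R d * RP R d)%type).
  by apply: continuous_to_kification => [|?]; [exact: compact_RP2|exact: cvg_id].
pose p (r : R) : pathspace R (RP R d) := g (b r).
have cp : continuous p.
  have ckb : continuous (b : R -> kification (RP R d * RP R d)%type).
    by move=> r; exact: (continuous_comp (cb r) (ck (b r))).
  have cgb : continuous (fun r => g (b r)).
    by move=> r; exact: (continuous_comp (ckb r) (cg (b r))).
  move=> r; exact: (continuous_comp (cgb r) (@continuous_kification_val _ _)).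
have pE r : (path_at (p r) (unit0 R), path_at (p r) (unit1 R)) = b r := gE (b r).
have X10 : X 1 = - X 0.
  rewrite /X mulr1 mulr0 /great_arc cospi sinpi cos0 sin0 !scale0r !addr0.
  by rewrite scaleN1r scale1r.
apply: (@no_contraction R d e0 X (fun ru => path_at (p ru.1) ru.2)) => //.
- by move=> j r; exact: (continuous_comp (cX r) (@coord_continuous _ _ _ 0 j (X r))).
- exact: continuous_path_at.
- by move=> u /=; rewrite /p /b X10 rpN.
- by move=> r; have [] := pE r.
- by move=> r; have [] := pE r.
Qed.

End lower_bound.

(** * Upper bound: a section with two-point supports *)

Section upper_bound.
Variables (R : realType) (d : nat).
Local Notation V := 'rV[R]_d.+1.
Local Notation I := (unit_interval R).
Local Notation P := (RP R d).

Definition arcs : set (V * V * R) :=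
  [set z | orthopair z.1.1 z.1.2 /\ 0 <= z.2 <= pi].

Lemma compact_arcs : compact arcs.
Proof.
have -> : arcs = (@sphere R d `*` @sphere R d `*` `[0, pi]%classic) `&`
    (fun z => dot z.1.1 z.1.2) @^-1` [set 0].
  apply/seteqP; split=> [[[x v] a] [[x1 v1 xv] a0]|[[x v] a]].
    by do !split=> //=; rewrite in_itv.
  by move=> [[[/= x1 v1]]]; rewrite /= in_itv /= => a0 xv; split.
apply: compact_closedI.
  apply: compact_setX (@segment_compact R 0 pi).
  exact: compact_setX (@compact_sphere R d) (@compact_sphere R d).
have cD : continuous (fun z : V * V * R => dot z.1.1 z.1.2).
  apply: continuous_dot => z; apply: continuous_comp.
  - exact: cvg_fst.
  - exact: cvg_fst.
  - exact: cvg_fst.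
  - exact: cvg_snd.
move/continuous_closedP : cD; apply.
by apply: accessible_closed_set1; apply: hausdorff_accessible; exact: Rhausdorff.
Qed.

(** The arcs, run at constant speed, are jointly continuous in [z] and time; currying gives the
    family of paths. *)
Lemma arc_paths (Z : topologicalType) (f g : Z -> V) (a : Z -> R) :
  continuous f -> continuous g -> continuous a ->
  (forall z, orthopair (f z) (g z)) ->
  exists2 p : Z -> pathspace R P, continuous p &
    forall z u, path_at (p z) u = rp (great_arc (f z) (g z) (a z * val u)).
Proof.
move=> cf cg ca fg.
have c1 (T : topologicalType) (k : Z -> T) :
    continuous k -> continuous (fun zu : Z * I => k zu.1).
  by move=> ck zu; apply: (continuous_comp (@cvg_fst _ _ _ _ _)); exact: ck.
have [|p cp pE] := @path_curry R P Z
    (fun zu => rp (great_arc (f zu.1) (g zu.1) (a zu.1 * val zu.2))); last first.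
  by exists p.
apply: continuous_rp => [|zu]; last exact: dot_arc.
have cu : continuous (fun zu : Z * I => val zu.2).
  move=> zu; apply: (@continuous_comp _ I R snd val); first exact: cvg_snd.
  exact: initial_continuous.
apply: continuous_arc; [exact: c1|exact: c1|move=> zu].
exact: (continuousM (c1 _ _ ca zu) (cu zu)).
Qed.

Lemma asecat_bound1_RP : (0 < d)%N -> asecat_bound R (@path_endpoints R P) 1.
Proof.
move=> d0.
pose Z : topologicalType := arcs.
have cZ : compact [set: Z] := compact_set_type compact_arcs.
pose x (z : Z) : V := (val z).1.1; pose v (z : Z) : V := (val z).1.2.
pose a (z : Z) : R := (val z).2.
have cval : continuous (val : Z -> V * V * R) by exact: initial_continuous.
have cval1 : continuous (fun z : Z => (val z).1).
  by move=> z; apply: (continuous_comp (cval z)); exact: cvg_fst.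
have cx : continuous x.
  by move=> z; apply: (continuous_comp (cval1 z)); exact: cvg_fst.
have cv : continuous v.
  by move=> z; apply: (continuous_comp (cval1 z)); exact: cvg_snd.
have ca : continuous a.
  by move=> z; apply: (continuous_comp (cval z)); exact: cvg_snd.
have xv z : orthopair (x z) (v z) by have [] := set_valP z.
have a0 z : 0 <= a z <= pi by have [] := set_valP z.
have a0' z : 0 <= pi - a z <= pi by have := a0 z; lra.
have [p1 cp1 p1E] := arc_paths cx cv ca xv.
have cNv : continuous (fun z => - v z) by move=> z; exact: (continuousN (cv z)).
have cNa : continuous (fun z => pi - a z).
  by move=> z; exact: (continuousB (@cst_continuous _ _ pi z) (ca z)).
have [p2 cp2 p2E] := arc_paths cx cNv cNa (fun z => orthopairN (xv z)).
(* The first weight vanishes exactly at angle pi, where the first arc is a half circle of arbitrary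
   direction; the second, [1 - w z], vanishes at angle 0, where the second arc is one. *)
pose w (z : Z) : R := (1 + cos (a z)) / 2.
have w01 z : 0 <= w z <= 1.
  by have := cos_geN1 (a z); have := cos_le1 (a z); rewrite /w; lra.
have cw : continuous w.
  have cc : continuous (fun z => cos (a z)).
    by move=> z; exact: (continuous_comp (ca z) (@continuous_cos R (a z))).
  move=> z; apply: (@continuousM _ _ (fun z => 1 + cos (a z)) (fun=> 2^-1)).
    exact: (cvgD (cvg_cst _) (cc z)).
  exact: cst_continuous.
pose S (z : Z) : fmeasure R (kification (pathspace R P)) :=
  two_point (p1 z : kification (pathspace R P)) (p2 z) (w01 z).
have cS : continuous S.
  by apply: continuous_two_point => //; exact: continuous_to_kification.
pose y (z : Z) := great_arc (x z) (v z) (a z).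
have y1 z : dot (y z) (y z) = 1 by exact: dot_arc.
have x1 z : dot (x z) (x z) = 1 by have [] := xv z.
pose q (z : Z) : kification (P * P)%type := (rp (x z), rp (y z)).
have cq : continuous q.
  apply: continuous_to_kification => //; apply: continuous_pair.
    exact: continuous_rp.
  by apply: continuous_rp => //; exact: continuous_arc.
have epE (g : kification (pathspace R P)) :
  path_endpoints g = (path_at g (unit0 R), path_at g (unit1 R)) by [].
have u0 b : b * val (unit0 R) = 0 := mulr0 b.
have u1 b : b * val (unit1 R) = b := mulr1 b.
have p1q z : path_endpoints (p1 z : kification (pathspace R P)) = q z.
  by rewrite epE !p1E u0 u1 great_arc0.
have p2q z : path_endpoints (p2 z : kification (pathspace R P)) = q z.
  by rewrite epE !p2E u0 u1 great_arc0 great_arc_supplement (rpN (y1 z)).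
have suppS z : @path_endpoints R P @` supp (S z) = [set q z].
  apply/seteqP; split=> [_ [m /supp_two_point_sub[->|->] <-]|_ ->] //=.
  have [m Sm] := supp_two_point_neq0 (p1 z : kification _) (p2 z) (w01 z).
  by exists m => //; case: (supp_two_point_sub Sm) => ->.
(* [S] is constant on the fibers of [q]. Equal lines leave a sign for [x] and a sign for [y]: if the
   signs agree each arc is preserved, if they differ the two arcs and their weights are
   exchanged. *)
have Sq z z' : q z = q z' -> S z = S z'.
  have cw0 t : w t != 0 -> cos (a t) != - 1.
    by apply: contra => /eqP ct; apply/eqP; rewrite /w ct; lra.
  have cw1 t : w t != 1 -> cos (pi - a t) != - 1.
    rewrite cosB cospi sinpi; apply: contra => /eqP ct; apply/eqP.
    by rewrite /w; lra.
  move=> [/(rp_eq (x1 z) (x1 z')) xx /(rp_eq (y1 z) (y1 z')) yy].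
  have [e e2 xe] : exists2 e : R, e ^+ 2 = 1 & x z' = e *: x z.
    case: xx => ->; first by exists 1; rewrite ?expr1n ?scale1r.
    by exists (- 1); rewrite ?sqrrN ?expr1n // scaleN1r opprK.
  have e1 : e = 1 \/ e = - 1.
    by move/eqP: e2; rewrite sqrf_eq1 => /orP[]/eqP ->; [left|right].
  have [ye|ye] : y z' = e *: y z \/ y z' = - (e *: y z).
    by case: e1 yy => -> [] ->; rewrite ?scale1r ?scaleN1r ?opprK; auto.
  - have [aE H1] := rp_arc_eq e2 (xv z) (xv z') (a0 z) (a0 z') xe ye.
    have ye2 : great_arc (x z') (- v z') (pi - a z') =
        e *: great_arc (x z) (- v z) (pi - a z).
      by rewrite !great_arc_supplement scalerN -/(y z') ye.
    have [_ H2] := rp_arc_eq e2 (orthopairN (xv z)) (orthopairN (xv z'))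
      (a0' z) (a0' z') xe ye2.
    apply: eq_two_point; first by rewrite /w aE.
    + by move=> /cw0/H1 h; apply: path_ext => u; rewrite !p1E h.
    + by move=> /cw1/H2 h; apply: path_ext => u; rewrite !p2E h.
  - have ye1 : great_arc (x z') (- v z') (pi - a z') = e *: great_arc (x z) (v z) (a z).
      by rewrite great_arc_supplement -/(y z') ye opprK.
    have ye2 : great_arc (x z') (v z') (a z') = e *: great_arc (x z) (- v z) (pi - a z).
      by rewrite great_arc_supplement scalerN -ye.
    have [aE H1] := rp_arc_eq e2 (xv z) (orthopairN (xv z')) (a0 z) (a0' z') xe ye1.
    have [_ H2] := rp_arc_eq e2 (orthopairN (xv z)) (xv z') (a0' z) (a0 z') xe ye2.
    have w01' : 0 <= 1 - w z' <= 1 by have := w01 z'; lra.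
    rewrite [RHS](two_point_swap _ _ (w01 z') w01' erefl).
    apply: eq_two_point.
    + by rewrite /w -aE cosB cospi sinpi; lra.
    + by move=> /cw0/H1 h; apply: path_ext => u; rewrite p1E p2E h.
    + by move=> /cw1/H2 h; apply: path_ext => u; rewrite p1E p2E h.
have qsurj b : exists z, q z = b.
  case: b => b1 b2.
  have [x' x'1 <-] := rp_surj b1; have [y' y'1 <-] := rp_surj b2.
  have [v' [a' [xv' a0'' <-]]] := arc_surj d0 x'1 y'1.
  have zA : arcs (x', v', a') by [].
  by exists (exist (fun z => z \in arcs) _ (mem_set zA)).
(* These preimages are chosen without any continuity; that of the section comes from
   [continuous_factor]. *)
have [zb zbE] := choice qsurj.
have sE b : fmeasure_over (@path_endpoints R P) (S (zb b)).
  by exists b; rewrite suppS zbE.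
exists (fun b => exist (fun m => m \in fmeasure_over (@path_endpoints R P))
  _ (mem_set (sE b))).
split.
- apply: continuous_comp_initial.
  (* Both coordinates stay continuous for the finer kified topology and take values in a Hausdorff
     space. *)
  have hB : hausdorff_space (kification (P * P)%type).
    move=> [b1 b2] [c1 c2] bc.
    have cid := @continuous_kification_val (P * P)%type.
    congr (_, _).
      apply: (cluster_continuous (@hausdorff_RP R d)
        (f := fun b : kification (P * P)%type => b.1) _ bc).
      by move=> b; apply: (continuous_comp (cid b)); exact: cvg_fst.
    apply: (cluster_continuous (@hausdorff_RP R d)
      (f := fun b : kification (P * P)%type => b.2) _ bc).
    by move=> b; apply: (continuous_comp (cid b)); exact: cvg_snd.
  apply: (continuous_factor cZ hB cq cS qsurj) => z /=.
  by apply: Sq; rewrite zbE.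
- move=> b; set m := exist _ _ _.
  have := fmeasure_projE m; rewrite suppS zbE => /seteqP[+ _].
  by move=> /(_ b erefl) ->.
- by move=> b; exact: fmeasure_le_two_point.
Qed.

End upper_bound.

Theorem proposition6p9 (R : realType) (d : nat) (hd : (0 < d)%N) :
  ATC R (RP R d) = 1%E.
Proof.
apply/(@asecat_natP _ _ _ _ 1); split; first exact: asecat_bound1_RP.
by case=> // /(not_asecat_bound0_RP hd).
Qed.
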